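(* For a distributed storage system $\mathcal{D}(n,k,d)$ with $d=n-1$ and a passive eavesdropper observing $\ell<k$ nodes, the secrecy capacity in the bandwidth-limited regime with repair-bandwidth budget $\Gamma$ is \[ C_s^{BL}(\Gamma)=\sum_{i=\ell+1}^{k}(n-i)\beta,\qquad \beta=\frac{\Gamma}{n-1}, \] and this value is achieved with node storage capacity $\alpha=\Gamma$.
   Context: A distributed storage system (DSS) $\mathcal{D}(n,k,d)$, $k\le d\le n-1$: a source holds a file, modeled as a random variable $S$ uniform over $\mathbb{F}_q^R$ (so $H(S)=R$, entropy in base $q$), which is encoded and stored on $n$ storage nodes, each storing at most $\alpha$ symbols of $\mathbb{F}_q$. Nodes fail one at a time; each failed node is replaced by a new node that connects to some $d$ of the remaining $n-1$ active nodes and downloads $\beta=\gamma/d$ symbols from each (symmetric repair; $\gamma$ is the repair bandwidth), then stores at most $\alpha$ symbols computed from the downloaded data. For a node $v_i$, $D_i$ denotes all data it downloads when joining and $C_i$ the data it stores. Reconstruction property: for every failure/repair sequence and every set $B$ of $k$ simultaneously active nodes, $H(S\mid C_B)=0$. A passive eavesdropper may choose any set $E$ of at most $\ell$ nodes among all nodes ever in the system (possibly at different times) and observes $D_E$; perfect secrecy requires $H(S\mid D_E)=H(S)$ for all such $E$. The secrecy capacity $C_s(\alpha,\gamma)$ is the supremum of $H(S)$ over schemes satisfying reconstruction and perfect secrecy. The bandwidth-limited secrecy capacity is $C_s^{BL}(\Gamma)=\sup_{\gamma\le\Gamma,\ \alpha\ge 0}C_s(\alpha,\gamma)$. Symbol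 counts are taken so that $\beta=\Gamma/(n-1)$ is a positive integer and the field size $q$ is large enough for the required MDS codes to exist. *)

(* Defs.v *)
From HB Require Import structures.
From mathcomp Require Import all_boot all_algebra all_field.
From Stdlib Require Import Reals.

Set Implicit Arguments.
Unset Strict Implicit.
Unset Printing Implicit Defensive.

Section Entropy.
Variables (Omega : finType) (P : Omega -> R) (q : nat).

Definition logq (x : R) : R := (ln x / ln (INR q))%R.

Definition pmf (T : finType) (X : Omega -> T) (t : T) : R :=
  \big[Rplus/0%R]_(w | X w == t) P w.

(* H(X) = - sum_t p(t) log_q p(t); Stdlib's ln 0 = 0 gives 0 log 0 = 0 *)
Definition entropy (T : finType) (X : Omega -> T) : R :=
  (- \big[Rplus/0%R]_(t : T) (pmf X t * logq (pmf X t)))%R.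

Definition cond_entropy (T U : finType) (X : Omega -> T) (Y : Omega -> U) : R :=
  (entropy (fun w => (X w, Y w)) - entropy Y)%R.

End Entropy.

Section DSS.
Variables (F : finFieldType) (n d alpha beta Rf : nat).

(* one failure/repair step: (position of the failed node, helper set) *)
Definition step := ('I_n * {set 'I_n})%type.

Definition valid_hist (h : seq step) : bool :=
  all (fun st : step => (st.1 \notin st.2) && (#|st.2| == d)) h.

(* A scheme: the source uses a random key (any finite distribution) to
   encode the file into the n initial nodes; at each repair, helper j sends
   beta symbols computed from its stored content (the rule may depend on the
   whole failure/repair history, current step included); the new node stores
   alpha symbols computed from what it downloaded. *)
Unset Implicit Arguments.
Record scheme := Scheme {
  key : finType;
  PK : key -> R;
  enc : 'rV[F]_Rf -> key -> 'I_n -> 'rV[F]_alpha;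
  msg : seq step -> 'I_n -> 'rV[F]_alpha -> 'rV[F]_beta;
  store : seq step -> {ffun 'I_n -> 'rV[F]_beta} -> 'rV[F]_alpha
}.
Set Implicit Arguments.

Section Semantics.
Variable c : scheme.

Definition Omega := ('rV[F]_Rf * key c)%type.

Definition Prob (w : Omega) : R := (/ INR (#|F| ^ Rf) * PK c w.2)%R.

(* data downloaded by the new node at the step h_last, where prev is the
   content of the active nodes just before that step; entries of
   non-helpers are 0 *)
Definition dl (prev : 'I_n -> 'rV[F]_alpha) (h : seq step) (H : {set 'I_n})
  : {ffun 'I_n -> 'rV[F]_beta} :=
  [ffun j => if j \in H then msg c h j (prev j) else GRing.zero].

Fixpoint st_rev (w : Omega) (hr : seq step) : 'I_n -> 'rV[F]_alpha :=
  match hr with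
  | [::] => enc c w.1 w.2
  | st :: hr' =>
      let prev := st_rev w hr' in
      fun i => if i == st.1 then store c (rev hr) (dl prev (rev hr) st.2)
               else prev i
  end.

Definition state (w : Omega) (h : seq step) : 'I_n -> 'rV[F]_alpha :=
  st_rev w (rev h).

Definition download (w : Omega) (h : seq step) (t : nat)
  : {ffun 'I_n -> 'rV[F]_beta} :=
  if drop t h is st :: _ then dl (state w (take t h)) (take t.+1 h) st.2
  else [ffun=> GRing.zero].

(* nodes ever in the system along h: the n initial nodes, and the node
   created at each step t < size h *)
Definition node (h : seq step) := ('I_n + 'I_(size h))%type.

Definition obsT := ('rV[F]_alpha + {ffun 'I_n -> 'rV[F]_beta})%type.

(* D_v: initial nodes download their content from the source *)
Definition obs (w : Omega) (h : seq step) (x : node h) : obsT :=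
  match x with
  | inl i => inl (enc c w.1 w.2 i)
  | inr t => inr (download w h t)
  end.

Definition S_rv (w : Omega) : 'rV[F]_Rf := w.1.

Definition C_rv (h : seq step) (B : {set 'I_n}) (w : Omega)
  : {ffun 'I_n -> option 'rV[F]_alpha} :=
  [ffun i => if i \in B then Some (state w h i) else None].

Definition D_rv (h : seq step) (E : {set node h}) (w : Omega)
  : {ffun node h -> option obsT} :=
  [ffun x => if x \in E then Some (obs w x) else None].

Definition Hq (T : finType) (X : Omega -> T) := entropy Prob #|F| X.
Definition Hq_cond (T U : finType) (X : Omega -> T) (Y : Omega -> U) :=
  cond_entropy Prob #|F| X Y.

Definition secure_scheme (k l : nat) : Prop :=
  [/\ (forall z, 0 <= PK c z)%R,
      \big[Rplus/0%R]_(z : key c) PK c z = 1%R,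
      (forall h, valid_hist h -> forall B : {set 'I_n}, #|B| = k ->
          Hq_cond S_rv (C_rv h B) = 0%R)
    & (forall h, valid_hist h -> forall E : {set node h}, #|E| <= l ->
          Hq_cond S_rv (D_rv E) = Hq S_rv)].

End Semantics.

End DSS.

Definition achievable (F : finFieldType) (n k d l alpha beta Rf : nat) : Prop :=
  exists c : scheme F n alpha beta Rf, secure_scheme d c k l.

(* the set of achievable H(S) (= Rf) under a repair-bandwidth budget Gamma:
   gamma = d * beta' <= Gamma, any alpha *)
Definition BL_rates (F : finFieldType) (n k d l Gamma : nat) (x : R) : Prop :=
  exists alpha beta' Rf : nat,
    d * beta' <= Gamma /\ achievable F n k d l alpha beta' Rf /\ x = INR Rf.

Definition secrecy_capacity_BL (F : finFieldType) (n k d l Gamma : nat) (c : R)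
  : Prop := is_lub (BL_rates F n k d l Gamma) c.

(* Main.v *)
(* Converse: let nodes 0..k-1 fail in turn and let the eavesdropper see the first l
   repairs.  Equality in Gibbs' inequality turns secrecy into a statement on
   supports: every file is compatible with one common observation.  Given it, the
   file is determined by the symbols that each later newcomer i < k receives from
   the n - 1 - i nodes that have not failed yet, so counting bounds its length.

   Achievability (repair by transfer): put beta symbols on each edge of the complete
   graph on the n nodes; a node stores the symbols of its edges, and a repair copies
   them from the neighbours, so the contents never change.  The symbols of edge A are
   the values at a(A), for injective a, of beta polynomials whose K low coefficients
   form the uniform key and whose other coefficients form the file, where K is the
   number of edges meeting l nodes.  The edges meeting k nodes are numerous enough to
   interpolate, while at most K values can be matched by changing the key alone. *)

Require Import Defs.
From HB Require Import structures.
From mathcomp Require Import all_boot all_algebra all_field.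
From mathcomp Require Import zify.
From Stdlib Require Import Reals Lra.

Set Implicit Arguments.
Unset Strict Implicit.
Unset Printing Implicit Defensive.

(** * Finite sums of real numbers *)

Section RealSums.
Local Open Scope R_scope.

Fact RplusA : associative Rplus. Proof. by move=> x y z; lra. Qed.
Fact RplusC : commutative Rplus. Proof. exact: Rplus_comm. Qed.
Fact Rplus0l : left_id 0 Rplus. Proof. exact: Rplus_0_l. Qed.
Fact Rmul0l : left_zero 0 Rmult. Proof. exact: Rmult_0_l. Qed.
Fact Rmul0r : right_zero 0 Rmult. Proof. exact: Rmult_0_r. Qed.
Fact RmulDl : left_distributive Rmult Rplus. Proof. by move=> x y z; lra. Qed.
Fact RmulDr : right_distributive Rmult Rplus. Proof. by move=> x y z; lra. Qed.

(** These instances open the generic [bigop] lemmas (splitting, reindexing, distributivity) to sums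
    in [R]. *)
HB.instance Definition _ := Monoid.isComLaw.Build R 0 Rplus RplusA RplusC Rplus0l.
HB.instance Definition _ := Monoid.isMulLaw.Build R 0 Rmult Rmul0l Rmul0r.
HB.instance Definition _ := Monoid.isAddLaw.Build R Rmult Rplus RmulDl RmulDr.

Variable I : finType.
Implicit Types (A B : pred I) (f g : I -> R).

Lemma Rsum_ge0 A f : (forall i, A i -> 0 <= f i) -> 0 <= \big[Rplus/0]_(i | A i) f i.
Proof. by move=> f0; apply: big_ind => // [|x y] /=; lra. Qed.

Lemma Rsum_opp A f :
  \big[Rplus/0]_(i | A i) (- f i) = - \big[Rplus/0]_(i | A i) f i.
Proof. by apply: (big_ind2 (fun x y => x = - y)) => [|x x' y y' -> ->|//] /=; lra. Qed.

Lemma Rsum_sub f g :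
  \big[Rplus/0]_i (f i - g i) = \big[Rplus/0]_i f i - \big[Rplus/0]_i g i.
Proof. by rewrite /Rminus big_split /= Rsum_opp. Qed.

Lemma Rsum_const (c : R) : \big[Rplus/0]_(i : I) c = INR #|I| * c.
Proof.
by rewrite big_const; elim: #|I| => [|m IH] /=; last (rewrite IH; case: m {IH} => [|m] /=); lra.
Qed.

Lemma Rsum_le_mem A f i :
  (forall j, A j -> 0 <= f j) -> A i -> f i <= \big[Rplus/0]_(j | A j) f j.
Proof.
move=> f0 Ai; rewrite (bigD1 i) //=.
suff : 0 <= \big[Rplus/0]_(j | A j && (j != i)) f j by lra.
by apply: Rsum_ge0 => j /andP[/f0].
Qed.

Lemma Rsum_eq0 f :
  (forall i, 0 <= f i) -> \big[Rplus/0]_i f i = 0 -> forall i, f i = 0.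
Proof.
move=> f0 s0 i; have := @Rsum_le_mem xpredT f i (fun j _ => f0 j) isT.
by have := f0 i; rewrite s0; lra.
Qed.

End RealSums.

Lemma ln_nondecreasing x y : (0 < x -> x <= y -> ln x <= ln y)%R.
Proof. by move=> x0 [xy|->]; [left; apply: ln_increasing | right]. Qed.

Lemma ln_div x y : (0 < x -> 0 < y -> ln (x / y) = ln x - ln y)%R.
Proof.
by move=> x0 y0; rewrite /Rdiv ln_mult // ?ln_Rinv //; apply: Rinv_0_lt_compat.
Qed.

(** * Conditional entropy: determination, independence and supports *)

Section EntropyFacts.
Local Open Scope R_scope.
Variables (W : finType) (P : W -> R) (q : nat).
Hypotheses (P_ge0 : forall w, 0 <= P w) (q_gt1 : (1 < q)%nat).
Variables (T U : finType) (X : W -> T) (Y : W -> U).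
Local Notation XY := (fun w => (X w, Y w)).

Lemma ln_q_gt0 : 0 < ln (INR q).
Proof. by rewrite -ln_1; apply: ln_increasing; [lra | apply: (lt_INR 1); apply/ltP]. Qed.

Lemma pmf_ge0 (V : finType) (Z : W -> V) v : 0 <= pmf P Z v.
Proof. by apply: Rsum_ge0. Qed.

Lemma pmf_ge (V : finType) (Z : W -> V) w : P w <= pmf P Z (Z w).
Proof. by apply: Rsum_le_mem => [j _|/=]. Qed.

Lemma pmf_gt0 (V : finType) (Z : W -> V) v :
  0 < pmf P Z v -> exists2 w, Z w = v & 0 < P w.
Proof.
(* [Rlt_dec] makes positivity boolean, so that existence over the finite [W] can be decided. *)
move=> pv; case: (boolP [exists w, (Z w == v) && (if Rlt_dec 0 (P w) then true else false)]).
  by move=> /existsP[w /andP[/eqP Zw]]; case: Rlt_dec => // Pw _; exists w.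
move=> /existsPn none; suff: pmf P Z v = 0 by lra.
rewrite /pmf big1 // => w Zw; have := none w; rewrite Zw /=.
by case: Rlt_dec => // np _; have := P_ge0 w; lra.
Qed.

Lemma sum_pmf (V : finType) (Z : W -> V) :
  \big[Rplus/0]_v pmf P Z v = \big[Rplus/0]_w P w.
Proof. by rewrite /pmf [RHS](partition_big Z xpredT). Qed.

Lemma pmf_marginr u : pmf P Y u = \big[Rplus/0]_t pmf P XY (t, u).
Proof.
rewrite {1}/pmf (partition_big X xpredT) //=; apply: eq_bigr => t _.
by apply: eq_bigl => w; rewrite xpair_eqE andbC.
Qed.

Lemma pmf_le_marginr v : pmf P XY v <= pmf P Y v.2.
Proof.
rewrite pmf_marginr; case: v => t u /=.
by apply: (@Rsum_le_mem _ _ (fun t => pmf P XY (t, u))) => // t' _; apply: pmf_ge0.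
Qed.

(** In this form no term is negative, because a joint mass never exceeds its marginal; the extreme
    cases can then be read off term by term. *)
Lemma cond_entropyE :
  cond_entropy P q X Y =
  \big[Rplus/0]_v (pmf P XY v * (logq q (pmf P Y v.2) - logq q (pmf P XY v))).
Proof.
rewrite /cond_entropy /entropy.
rewrite [RHS](eq_bigr (fun v => pmf P XY v * logq q (pmf P Y v.2)
                           - pmf P XY v * logq q (pmf P XY v))); last by move=> v _ /=; ring.
rewrite Rsum_sub; set A := \big[_/_]_(t : T * U) _; set B := \big[_/_]_(t : U) _.
suff -> : \big[Rplus/0]_v (pmf P XY v * logq q (pmf P Y v.2)) = B by lra.
rewrite -(pair_bigA _ (fun t u => pmf P XY (t, u) * logq q (pmf P Y u))) exchange_big /=.
by apply: eq_bigr => u _; rewrite -big_distrl /= -pmf_marginr.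
Qed.

(** All terms of the sum vanish, so a positive joint mass equals its marginal. A second value of [X]
    with the same [Y] would add mass to that marginal. *)
Lemma cond_entropy0_determined w w' : cond_entropy P q X Y = 0 ->
  0 < P w -> 0 < P w' -> Y w = Y w' -> X w = X w'.
Proof.
rewrite cond_entropyE => s0 Pw Pw' Yww'; have lq := ln_q_gt0.
have /Rsum_eq0/(_ s0)/(_ (XY w)) /= : forall v,
    0 <= pmf P XY v * (logq q (pmf P Y v.2) - logq q (pmf P XY v)).
  move=> v; case: (pmf_ge0 XY v) => [pv|<-]; last by lra.
  apply: Rmult_le_pos; first by lra.
  rewrite /logq -Rdiv_minus_distr; apply: Rmult_le_pos; last by left; apply: Rinv_0_lt_compat.
  suff : ln (pmf P XY v) <= ln (pmf P Y v.2) by lra.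
  by apply: ln_nondecreasing pv (pmf_le_marginr v).
have pw := pmf_ge XY w; have pw' := pmf_ge Y w.
move=> /Rmult_integral[|]; first by lra.
rewrite /logq -Rdiv_minus_distr => /Rmult_integral[|]; last first.
  by have := Rinv_0_lt_compat _ lq; lra.
move=> /Rminus_diag_uniq /ln_inv eqp.
have {}eqp : pmf P Y (Y w) = pmf P XY (X w, Y w) by apply: eqp => /=; lra.
case: (eqVneq (X w) (X w')) => // Xww'.
suff : pmf P XY (X w, Y w) + pmf P XY (X w', Y w) <= pmf P Y (Y w).
  by have := pmf_ge XY w'; rewrite -Yww'; lra.
rewrite [X in _ <= X]pmf_marginr (bigD1 (X w)) //=; apply: Rplus_le_compat_l.
apply: (@Rsum_le_mem _ (fun t => t != X w) (fun t => pmf P XY (t, Y w))).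
  by move=> t _; apply: pmf_ge0.
by rewrite eq_sym.
Qed.

(** The tangent bound behind Gibbs' inequality, from exp y >= 1 + y. *)
Lemma ln_le_sub1 x : 0 < x -> ln x <= x - 1.
Proof.
move=> x0; rewrite -[X in _ <= X]ln_exp; apply: ln_nondecreasing => //.
by have := exp_ineq1_le (x - 1); lra.
Qed.

(* The equality case of Gibbs' inequality, reduced to the supports: each term of
   H(X|Y) - log |T| is at most p(y)/|T| - p(x,y), and these bounds sum to 0. *)
Lemma cond_entropy_max_support t w : \big[Rplus/0]_w P w = 1 ->
  cond_entropy P q X Y = logq q (INR #|T|) -> 0 < P w ->
  exists w', [/\ 0 < P w', X w' = t & Y w' = Y w].
Proof.
move=> P1; rewrite cond_entropyE => HXY Pw; have lq := ln_q_gt0.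
have N0 : 0 < INR #|T| by apply: lt_0_INR; apply/ltP/card_gt0P; exists t.
pose g v := pmf P Y v.2 / INR #|T| - pmf P XY v
  - pmf P XY v * (ln (pmf P Y v.2) - ln (pmf P XY v) - ln (INR #|T|)).
have pY : 0 < pmf P Y (Y w) by have := pmf_ge Y w; lra.
suff /(_ (t, Y w)) : forall v, g v = 0.
  rewrite /g /=; case: (pmf_ge0 XY (t, Y w)) => [/pmf_gt0[w' [<- eqY] Pw'] _|<-].
    by exists w'.
  (* If the joint mass were 0, [g] would reduce to [pmf P Y (Y w) / INR #|T|], which is positive. *)
  have := Rdiv_lt_0_compat _ _ pY N0; rewrite Rmult_0_l !Rminus_0_r => p0 p0'.
  by rewrite p0' in p0; have := Rlt_irrefl _ p0.
apply: Rsum_eq0.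
  move=> v; rewrite /g; case: (pmf_ge0 XY v) => [pv|<-]; last first.
    rewrite Rmult_0_l !Rminus_0_r; apply: Rmult_le_pos; first exact: pmf_ge0.
    by left; apply: Rinv_0_lt_compat.
  have pv2 := pmf_le_marginr v; have pv2' : 0 < pmf P Y v.2 by lra.
  have x0 : 0 < pmf P Y v.2 / (INR #|T| * pmf P XY v).
    by apply: Rdiv_lt_0_compat => //; apply: Rmult_lt_0_compat.
  have := ln_le_sub1 x0; rewrite ln_div //; last exact: Rmult_lt_0_compat.
  rewrite ln_mult // => /(Rmult_le_compat_l _ _ _ (pmf_ge0 XY v)).
  have -> : pmf P XY v * (pmf P Y v.2 / (INR #|T| * pmf P XY v) - 1)
     = pmf P Y v.2 / INR #|T| - pmf P XY v by field; lra.
  by lra.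
rewrite /g !Rsum_sub sum_pmf P1.
rewrite -(pair_bigA _ (fun _ u => pmf P Y u / INR #|T|)) Rsum_const -big_distrl /= sum_pmf P1.
rewrite (eq_bigr (fun v => ln (INR q) * (pmf P XY v * (logq q (pmf P Y v.2) - logq q (pmf P XY v)))
           - pmf P XY v * ln (INR #|T|))).
  rewrite Rsum_sub -big_distrr -big_distrl /= sum_pmf P1 HXY /logq.
  by move: (INR #|T|) (ln (INR q)) N0 lq => a b a0 b0; field; lra.
by move=> v _ /=; rewrite /logq; move: (ln (INR q)) lq => b b0; field; lra.
Qed.

Lemma cond_entropy_determined (g : U -> T) :
  (forall w, X w = g (Y w)) -> cond_entropy P q X Y = 0.
Proof.
move=> Xg; rewrite cond_entropyE big1 // => -[t u] _ /=.
case: (altP (t =P g u)) => [->|tg].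
  suff -> : pmf P XY (g u, u) = pmf P Y u by lra.
  apply: eq_bigl => w; rewrite xpair_eqE Xg.
  by case: (eqVneq (Y w) u) => [->|_]; rewrite ?eqxx // andbF.
suff -> : pmf P XY (t, u) = 0 by lra.
rewrite /pmf big_pred0 // => w; rewrite xpair_eqE Xg.
by apply/negP => /andP[/eqP gt /eqP Yu]; rewrite -gt Yu eqxx in tg.
Qed.

Lemma cond_entropy_indep :
  (forall t u, pmf P XY (t, u) = pmf P X t * pmf P Y u) -> \big[Rplus/0]_w P w = 1 ->
  cond_entropy P q X Y = entropy P q X.
Proof.
move=> ind P1; rewrite cond_entropyE /entropy -Rsum_opp.
rewrite [LHS](eq_bigr (fun v => - (pmf P X v.1 * logq q (pmf P X v.1)) * pmf P Y v.2)); last first.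
  move=> [t u] _ /=; rewrite ind.
  (* [ln] of a product splits at positive masses; where one mass is 0, both sides vanish. *)
  case: (pmf_ge0 X t) => [p1|<-]; last by lra.
  case: (pmf_ge0 Y u) => [p2|<-]; last by lra.
  by rewrite /logq ln_mult //; field; have := ln_q_gt0; lra.
rewrite -(pair_bigA _ (fun t u => - (pmf P X t * logq q (pmf P X t)) * pmf P Y u)) /=.
by apply: eq_bigr => t _; rewrite -big_distrr /= sum_pmf P1; ring.
Qed.

End EntropyFacts.

Arguments key {F n alpha beta Rf} s.
Arguments PK {F n alpha beta Rf} s _.
Arguments enc {F n alpha beta Rf} s _ _ _.
Arguments msg {F n alpha beta Rf} s _ _ _.
Arguments store {F n alpha beta Rf} s _ _.
Arguments Prob {F n alpha beta Rf} c w.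
Arguments S_rv {F n alpha beta Rf} c w.

(** * Runs of a scheme and the law of the file *)

Section Semantics.
Variables (F : finFieldType) (n alpha beta Rf : nat) (c : scheme F n alpha beta Rf).
Implicit Types (w : Omega c) (h : seq (step n)).

Lemma state_rcons w h st i : state w (rcons h st) i =
  if i == st.1 then store c (rcons h st) (dl c (state w h) (rcons h st) st.2) else state w h i.
Proof. by rewrite /state rev_rcons /= rev_cons revK. Qed.

Lemma downloadE w h t st : t < size h -> nth st h t = st ->
  download w h t = dl c (state w (take t h)) (take t.+1 h) st.2.
Proof. by move=> th nst; rewrite /download (drop_nth st th) nst. Qed.

Lemma card_file : (#|F| ^ Rf)%nat = #|{: 'rV[F]_Rf}|.
Proof. by rewrite card_mx mul1n; elim: Rf => //= r ->; rewrite expnS. Qed.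

Lemma card_file_gt0 : (0 < INR (#|F| ^ Rf))%R.
Proof. by rewrite card_file; apply/lt_0_INR/ltP/card_gt0P; exists GRing.zero. Qed.

Lemma card_file_neq0 : INR #|{: 'rV[F]_Rf}| <> 0%R.
Proof. by rewrite -card_file; apply/Rgt_not_eq/card_file_gt0. Qed.

Hypotheses (PK_ge0 : forall z, (0 <= PK c z)%R) (PK_sum : \big[Rplus/0%R]_z PK c z = 1%R).

Lemma Prob_ge0 w : (0 <= Prob c w)%R.
Proof.
by apply: Rmult_le_pos => //; left; apply/Rinv_0_lt_compat/card_file_gt0.
Qed.

Lemma pmf_file s : pmf (Prob c) (S_rv c) s = (/ INR #|{: 'rV[F]_Rf}|)%R.
Proof.
rewrite /pmf -card_file -[RHS]Rmult_1_r -[in RHS]PK_sum big_distrr /=.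
rewrite (reindex_onto (fun z => (s, z)) snd) /=; last by move=> [s' z] /= /eqP <-.
by apply: eq_bigl => z; rewrite /S_rv !eqxx.
Qed.

Lemma Prob_sum : \big[Rplus/0%R]_(w : Omega c) Prob c w = 1%R.
Proof.
rewrite -(sum_pmf _ (S_rv c)) (eq_bigr _ (fun s _ => pmf_file s)) Rsum_const.
by rewrite -card_file Rinv_r //; apply/Rgt_not_eq/card_file_gt0.
Qed.

Lemma entropy_file : Hq (S_rv c) = logq #|F| (INR #|{: 'rV[F]_Rf}|).
Proof.
have N0 := card_file_gt0; rewrite card_file in N0.
rewrite /Hq /entropy (eq_bigr (fun _ => / INR #|{: 'rV[F]_Rf}| * logq #|F| (/ INR #|{: 'rV[F]_Rf}|))%R);
  last by move=> s _; rewrite pmf_file.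
rewrite Rsum_const /logq ln_Rinv // -Rmult_assoc Rinv_r; last exact: Rgt_not_eq.
by rewrite /Rdiv; ring.
Qed.

Lemma pmf_file_pair (U : finType) (Y : Omega c -> U) s u :
  pmf (Prob c) (fun w => (S_rv c w, Y w)) (s, u) =
  \big[Rplus/0%R]_(z | Y (s, z) == u) Prob c (s, z).
Proof.
rewrite /pmf (reindex_onto (fun z => (s, z)) snd) /=; last first.
  by move=> [s' z] /=; rewrite xpair_eqE => /andP[/eqP <-].
by apply: eq_bigl => z; rewrite xpair_eqE /S_rv !eqxx /= andbT.
Qed.

(** Reindexing the keys by [f] shows that the joint mass does not depend on the file; as the file is
    uniform, the joint law is a product. *)
Lemma file_independent (U : finType) (Y : Omega c -> U) :
  (forall s s', exists f : key c -> key c, bijective f /\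
     forall z, PK c (f z) = PK c z /\ Y (s', f z) = Y (s, z)) ->
  Hq_cond (S_rv c) Y = Hq (S_rv c).
Proof.
move=> rekey; have P0 := Prob_ge0; have N0 := card_file_neq0.
apply: cond_entropy_indep => //; [exact: finNzRing_gt1 | | exact: Prob_sum].
pose p s u := pmf (Prob c) (fun w => (S_rv c w, Y w)) (s, u).
have p_const s s' u : p s u = p s' u.
  rewrite /p !pmf_file_pair; have [f [bij_f fP]] := rekey s s'.
  rewrite [RHS](reindex f) /=; last exact: onW_bij.
  by apply: eq_big => z; rewrite /Prob /= ?(fP z).1 ?(fP z).2.
move=> s u; rewrite pmf_file (pmf_marginr _ (S_rv c) Y).
rewrite (eq_bigr (fun _ => p s u)) => [|s' _]; last exact: (p_const s' s u).
by rewrite Rsum_const -Rmult_assoc Rinv_l // Rmult_1_l.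
Qed.

End Semantics.

Lemma card_ord_lt p n : p <= n -> #|[set i : 'I_n | i < p]| = p.
Proof.
by move=> pn; rewrite cardsE -sum1_card -(big_ord_widen n (fun=> 1) pn) sum1_card card_ord.
Qed.

(** * Converse: the rate bound for every secure scheme *)

Section Converse.
Variables (F : finFieldType) (m alpha beta Rf : nat) (c : scheme F m.+1 alpha beta Rf).
Implicit Types (w : Omega c) (t : nat).

Definition fail_step t : step m.+1 := (inord t, ~: [set inord t]).
Definition fail_hist t : seq (step m.+1) := [seq fail_step i | i <- iota 0 t].

Lemma size_fail_hist t : size (fail_hist t) = t.
Proof. by rewrite size_map size_iota. Qed.

Lemma fail_histS t : fail_hist t.+1 = rcons (fail_hist t) (fail_step t).
Proof. by rewrite /fail_hist -[t.+1]addn1 iotaD map_cat cats1. Qed.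

Lemma take_fail_hist t k : t <= k -> take t (fail_hist k) = fail_hist t.
Proof. by move=> tk; rewrite /fail_hist -map_take take_iota (minn_idPl tk). Qed.

Lemma valid_fail_hist t : valid_hist m (fail_hist t).
Proof.
apply/allP => _ /mapP[i _ ->] /=.
by rewrite !inE eqxx cardsC1 card_ord eqxx.
Qed.

Lemma download_fail_hist w k t : t < k -> download w (fail_hist k) t
  = dl c (state w (fail_hist t)) (fail_hist t.+1) (~: [set inord t]).
Proof.
move=> tk; rewrite (@downloadE _ _ _ _ _ c w _ _ (fail_step t)) ?size_fail_hist //.
  by rewrite !take_fail_hist // ltnW.
by rewrite (nth_map 0) ?size_iota // nth_iota.
Qed.

(** Induction on [t]. An observed newcomer stores a function of its download; a later one hears
    repaired helpers, equal by induction, and helpers that have not failed yet, equal by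
    hypothesis. *)
Lemma state_fail_hist_inj w w' l k : k <= m ->
  (forall t, t < l -> download w (fail_hist k) t = download w' (fail_hist k) t) ->
  (forall t j, l <= t < k -> t < j < m.+1 ->
     msg c (fail_hist t.+1) (inord j) (state w (fail_hist t) (inord j)) =
     msg c (fail_hist t.+1) (inord j) (state w' (fail_hist t) (inord j))) ->
  forall t, t <= k -> forall j, j < t ->
    state w (fail_hist t) (inord j) = state w' (fail_hist t) (inord j).
Proof.
move=> km eqD eqM; elim=> [//|t IH] tk j jt.
rewrite fail_histS !state_rcons -fail_histS /=.
have valE i : i < m.+1 -> (@inord m i : nat) = i by apply: inordK.
have [tm jm] : t < m.+1 /\ j < m.+1.
  by split; [exact: leq_trans tk (leqW km) | exact: leq_trans jt (leq_trans tk (leqW km))].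
have -> : (@inord m j == inord t) = (j == t) by rewrite -val_eqE /= !valE.
case: eqVneq => [_|jnt]; last first.
  by apply: IH; [exact: ltnW | rewrite ltn_neqAle jnt -ltnS].
congr (store c _ _); case: (ltnP t l) => [tl|lt].
  by have := eqD _ tl; rewrite !download_fail_hist.
apply/ffunP => i; rewrite !ffunE !inE; case: ifP => // it.
have {}it : (i : nat) != t by rewrite -(valE t) // val_eqE it.
rewrite -(inord_val i); case: (ltngtP i t) => [i_t|t_i|it']; last by rewrite it' eqxx in it.
  by rewrite IH // ltnW.
by apply: eqM; rewrite ?lt ?t_i ?ltn_ord.
Qed.

(** Pairs (newcomer, helper not yet failed) at the repairs that the eavesdropper misses. *)
Local Notation later_link l k := {x : 'I_k * 'I_m.+1 | l <= x.1 < x.2}.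

(** Step [t], counted from 0, has m - t helpers above it: the term of index i = t + 1. *)
Lemma card_later_links l k : k <= m ->
  #|{: later_link l k}| = \sum_(l.+1 <= i < k.+1) (m.+1 - i).
Proof.
move=> km; rewrite card_sig -sum1_card.
rewrite -(@pair_big_dep _ _ _ _ _ (fun t : 'I_k => l <= t)
  (fun (t : 'I_k) (j : 'I_m.+1) => t < j) (fun _ _ => 1)) /=.
rewrite big_add1 /= big_geq_mkord; apply: eq_bigr => t _.
by rewrite -[RHS]muln1 -sum_nat_const_nat big_geq_mkord.
Qed.

Lemma secure_rate_le k l : k <= m -> l < k -> secure_scheme m c k l ->
  Rf <= \sum_(l.+1 <= i < k.+1) (m.+1 - i) * beta.
Proof.
move=> km lk [PK0 PK1 recon secr]; pose h := fail_hist k.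
have F1 : 1 < #|F| := finNzRing_gt1 F.
have P0 := Prob_ge0 PK0; have P1 := Prob_sum PK1.
pose E : {set node h} := [set x : node h | if x is inr t then t < l else false].
pose B := [set i : 'I_m.+1 | i < k].
have cardB : #|B| = k by rewrite card_ord_lt // leqW.
have cardE : #|E| <= l.
  have -> : E = inr @: [set t : 'I_(size h) | t < l].
    apply/setP => x; rewrite inE; apply/idP/imsetP => [|[t]]; last by rewrite inE => tl ->.
    by case: x => // t tl; exists t => //; rewrite inE.
  rewrite card_imset; last by move=> ? ? [].
  by rewrite card_ord_lt // size_fail_hist ltnW.
have {}recon := recon h (valid_fail_hist k) B cardB.
have {}secr := secr h (valid_fail_hist k) E cardE.
have [w0 _ Pw0] : exists2 w, S_rv c w = GRing.zero & (0 < Prob c w)%R.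
  apply: (pmf_gt0 P0); rewrite pmf_file // -card_file.
  exact/Rinv_0_lt_compat/card_file_gt0.
(* Secrecy supplies, for each file, a possible outcome with the same observation as [w0]. *)
have /fin_all_exists [f fP] : forall s, exists w : Omega c,
    [/\ (0 < Prob c w)%R, S_rv c w = s & D_rv E w = D_rv E w0].
  move=> s; apply: (cond_entropy_max_support P0 F1 s P1 _ Pw0).
  by rewrite -(entropy_file PK1).
pose M s : {ffun later_link l k -> 'rV[F]_beta} :=
  [ffun x : later_link l k => msg c (fail_hist (val x).1.+1) (val x).2
               (state (f s) (fail_hist (val x).1) (val x).2)].
(* Equal messages on the later links force equal contents on [B], hence equal files by
   reconstruction. *)
have /leq_card : injective M.
  move=> s s' eqM; have [Ps Ss Ds] := fP s; have [Ps' Ss' Ds'] := fP s'.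
  rewrite -[LHS]Ss -[RHS]Ss'.
  apply: (cond_entropy0_determined P0 F1 recon Ps Ps').
  apply/ffunP => i; rewrite !ffunE inE; case: ifP => // ik; congr Some.
  rewrite -(inord_val i); apply: (@state_fail_hist_inj _ _ l k) => // [t tl|t j /andP[lt tk] /andP[tj jm]].
    have tk : t < size h by rewrite size_fail_hist (ltn_trans tl).
    move: (congr1 (fun o : {ffun _} => o (inr (Ordinal tk))) (etrans Ds (esym Ds'))).
    by rewrite !ffunE inE /= tl => -[].
  have xP : l <= (Ordinal tk, Ordinal jm).1 < (Ordinal tk, Ordinal jm).2 by rewrite /= lt.
  have := congr1 (fun g : {ffun later_link l k -> 'rV[F]_beta} =>
    g (exist _ (Ordinal tk, Ordinal jm) xP)) eqM; rewrite !ffunE /=.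
  by rewrite (_ : inord j = Ordinal jm) //; apply: val_inj; rewrite /= inordK.
rewrite card_ffun !card_mx !mul1n -expnM leq_exp2l // card_later_links //.
by rewrite mulnC big_distrl.
Qed.

End Converse.

(** * Counting the edges of the complete graph that meet a set of nodes *)

Section LinkCounting.
Variable n : nat.
Implicit Types (P A : {set 'I_n}).

(** Two-element sets stand for edges, so that both endpoints refer to the same symbols. *)
Definition links P := [set A : {set 'I_n} | (#|A| == 2) && ~~ [disjoint A & P]].

Lemma links_pair i j P : i != j -> i \in P -> [set i; j] \in links P.
Proof.
move=> ij iP; rewrite inE cards2 ij; apply/pred0Pn; exists i.
by rewrite /= !inE eqxx iP.
Qed.

Lemma linksP P A : A \in links P -> exists i j, [/\ i != j, i \in P & A = [set i; j]].
Proof.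
rewrite inE => /andP[/cards2P[i [j [ij ->]]] /pred0Pn[x /andP[/=]]].
rewrite !inE => /orP[]/eqP -> xP; first by exists i, j.
by exists j, i; rewrite eq_sym setUC.
Qed.

(** The edges that miss [P] are the pairs inside its complement. *)
Lemma card_links P : #|links P| + 'C(n - #|P|, 2) = 'C(n, 2).
Proof.
rewrite -[in RHS](card_ord n) -(card_draws _ 2).
rewrite -(cardsID [set A : {set 'I_n} | A \subset ~: P] [set A : {set 'I_n} | #|A| == 2]).
rewrite addnC; congr (_ + _).
  have -> : n - #|P| = #|~: P| by rewrite [RHS]cardsCs setCK card_ord.
  rewrite -cards_draws; apply: eq_card => A.
  by rewrite !inE andbC.
by apply: eq_card => A; rewrite !inE disjoints_subset andbC.
Qed.

(** The i-th node meets n - i edges not met by the previous ones; Pascal's rule makes the sum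
    telescope. *)
Lemma sum_new_links l k : l <= k <= n ->
  \sum_(l.+1 <= i < k.+1) (n - i) + 'C(n - k, 2) = 'C(n - l, 2).
Proof.
elim: k => [|k IH]; first by rewrite leqn0 => /andP[/eqP -> _]; rewrite big_geq.
rewrite leq_eqVlt => /andP[/predU1P[-> _|]]; first by rewrite big_geq.
rewrite ltnS => lk kn; rewrite big_nat_recr //= -IH ?lk ?(ltnW kn) //.
by rewrite -addnA; congr addn; rewrite -[n - k](subnSK kn) binS bin1 addnC.
Qed.

End LinkCounting.

(** * Achievability: repair by transfer with polynomial shares *)

Section RepairByTransfer.
Local Open Scope ring_scope.
Import GRing.Theory.
Variables (F : finFieldType) (m beta K r : nat) (a : {set 'I_m.+1} -> F).
Local Notation file := 'rV[F]_(beta * r).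
Local Notation rkey := 'M[F]_(beta, K).
Implicit Types (s : file) (z : rkey) (A P : {set 'I_m.+1}) (h : seq (step m.+1)).

(** [vec_mx] cuts the file into [beta] rows of length [r], one polynomial for each symbol of an
    edge. *)
Definition share_poly s z (b : 'I_beta) : {poly F} :=
  rVpoly (row b z) + rVpoly (row b (vec_mx s)) * 'X^K.

Definition link_symbols s z A : 'rV[F]_beta := \row_b (share_poly s z b).[a A].

Definition transfer_enc s z (i : 'I_m.+1) : 'rV[F]_(m * beta) :=
  mxvec (\matrix_(j < m) link_symbols s z [set i; lift i j]).

(* The default (ord0, set0) is never reached: messages are only sent along
   nonempty histories. *)
Definition failed_node h : 'I_m.+1 := (last (ord0, set0) h).1.

(** [unlift] finds the slot in which helper [i] keeps its edge to the failed node; it returns [None]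
    only when [i] is the failed node. *)
Definition transfer_msg h (i : 'I_m.+1) (x : 'rV[F]_(m * beta)) : 'rV[F]_beta :=
  if unlift i (failed_node h) is Some j then row j (vec_mx x) else 0.

Definition transfer_store h (y : {ffun 'I_m.+1 -> 'rV[F]_beta}) : 'rV[F]_(m * beta) :=
  mxvec (\matrix_(j < m) y (lift (failed_node h) j)).

Definition transfer_scheme : scheme F m.+1 (m * beta) beta (beta * r) :=
  Scheme F m.+1 (m * beta) beta (beta * r) rkey (fun=> / INR #|{: rkey}|)%R
    transfer_enc transfer_msg transfer_store.

Lemma size_share_poly s z b : (size (share_poly s z b) <= K + r)%nat.
Proof.
have szV d (v : 'rV[F]_d) : (size (rVpoly v) <= d)%nat by apply: size_poly.
rewrite (leq_trans (size_polyD _ _)) // geq_max (leq_trans (szV _ _)) ?leq_addr //=.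
by rewrite (leq_trans (size_polyMleq _ _)) // size_polyXn addnS /= addnC leq_add2l szV.
Qed.

(** [drop_poly K] strips the key and leaves the coefficients of the file. *)
Lemma share_poly_inj s s' z z' :
  (forall b, share_poly s z b = share_poly s' z' b) -> s = s'.
Proof.
move=> eq_sh; rewrite -[s]vec_mxK -[s']vec_mxK; congr mxvec.
apply/row_matrixP => b; rewrite -[LHS]rVpolyK -[RHS]rVpolyK; congr poly_rV.
have := congr1 (drop_poly K) (eq_sh b).
by rewrite /share_poly !drop_polyDMXn //; apply: size_poly.
Qed.

Lemma vec_mx_transfer_enc s z i j :
  row j (vec_mx (transfer_enc s z i)) = link_symbols s z [set i; lift i j].
Proof. by rewrite mxvecK rowK. Qed.

Lemma dl_transfer h (st : step m.+1) prev s z :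
  (st.1 \notin st.2) && (#|st.2| == m) -> prev =1 transfer_enc s z ->
  dl transfer_scheme prev (rcons h st) st.2 =
  [ffun j => if j == st.1 then 0 else link_symbols s z [set j; st.1]].
Proof.
case: st => f H /= /andP[fH /eqP cH] prevE.
(* A set of [m] nodes that avoids the failed one is its whole complement. *)
have -> : H = ~: [set f].
  by apply/eqP; rewrite eqEcard subsetC sub1set inE fH cardsC1 card_ord cH /=.
apply/ffunP => j; rewrite !ffunE !inE; case: eqVneq => //= jf.
rewrite /transfer_msg /failed_node last_rcons /= prevE.
by have [t -> ->] := unlift_some jf; rewrite vec_mx_transfer_enc.
Qed.

Lemma state_transfer (w : Omega transfer_scheme) h :
  valid_hist m h -> state w h =1 transfer_enc w.1 w.2.
Proof.
elim/last_ind: h => [_ i //|h st IH]; rewrite /valid_hist all_rcons => /andP[vst vh] i.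
rewrite state_rcons; case: eqP => [->|_]; last exact: IH.
rewrite (dl_transfer _ vst (IH vh)) /= /transfer_store /failed_node last_rcons.
congr mxvec; apply/row_matrixP => j; rewrite !rowK ffunE.
by rewrite eq_sym (negbTE (neq_lift _ _)) setUC.
Qed.

Lemma download_transfer (w : Omega transfer_scheme) h t : valid_hist m h -> (t < size h)%nat ->
  let f := (nth (ord0, set0) h t).1 in
  download w h t = [ffun j => if j == f then 0 else link_symbols w.1 w.2 [set j; f]].
Proof.
move=> vh th /=; have nE : nth (nth (ord0, set0) h t) h t = nth (ord0, set0) h t.
  exact: set_nth_default.
rewrite (downloadE w th nE) (take_nth (ord0, set0) th); apply: dl_transfer.
  by move/allP: vh; apply; apply: mem_nth.
by apply: state_transfer; move: vh; rewrite -{1}(cat_take_drop t h) /valid_hist all_cat => /andP[].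
Qed.

Lemma transfer_enc_eq P s s' z z' i :
  {in links P, link_symbols s z =1 link_symbols s' z'} -> i \in P ->
  transfer_enc s z i = transfer_enc s' z' i.
Proof.
move=> eqL iP; congr mxvec; apply/row_matrixP => j; rewrite !rowK.
by apply/eqL/links_pair; rewrite ?neq_lift.
Qed.

Definition position h (x : node h) : 'I_m.+1 :=
  match x with inl i => i | inr t => (nth (ord0, set0) h t).1 end.

(** An observed node, initial or repaired, reveals only the edges at its position, so nodes observed
    at one position at different times count once. *)
Lemma D_rv_transfer_eq h (E : {set node h}) s s' z z' : valid_hist m h ->
  {in links (@position h @: E), link_symbols s z =1 link_symbols s' z'} ->
  @D_rv _ _ _ _ _ transfer_scheme h E (s, z) = @D_rv _ _ _ _ _ transfer_scheme h E (s', z').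
Proof.
move=> vh eqL; apply/ffunP => x; rewrite !ffunE; case: ifP => // xE; congr Some.
have xP : position x \in @position h @: E by apply: imset_f.
case: x xE xP => [i|t] _ /= xP; first by congr inl; apply: transfer_enc_eq xP.
congr inr; rewrite !download_transfer //=; apply/ffunP => j; rewrite !ffunE.
by case: eqP => // /eqP jf; rewrite setUC eqL // links_pair // eq_sym.
Qed.

Hypothesis a_inj : injective a.

(** A nonzero difference of share polynomials has size at most K + r, hence fewer than K + r roots;
    [a_inj] keeps the evaluation points distinct. *)
Lemma link_symbols_inj P s s' z z' : (K + r <= #|links P|)%nat ->
  {in links P, link_symbols s z =1 link_symbols s' z'} -> s = s'.
Proof.
move=> leL eqL; apply: (@share_poly_inj _ _ z z') => b; apply/eqP; rewrite -subr_eq0.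
apply: contraLR leL => d0; rewrite -ltnNge cardE -(size_map a).
apply: (@leq_trans (size (share_poly s z b - share_poly s' z' b))).
  apply: max_poly_roots => //; last by rewrite map_inj_uniq // enum_uniq.
  apply/allP => _ /mapP[A + ->]; rewrite mem_enum => /eqL /rowP/(_ b).
  by rewrite !mxE => eqb; rewrite /root hornerD hornerN eqb subrr.
by rewrite (leq_trans (size_polyD _ _)) // size_polyN geq_max !size_share_poly.
Qed.

(* The polynomial (s - s') X^K is reduced modulo the product of the X - a(A) over
   the observed links A: the remainder has degree < K and the same values there,
   so it can be absorbed by the key. *)
Lemma link_symbols_rekey P s s' : (#|links P| <= K)%nat ->
  exists d : rkey, forall z, {in links P, link_symbols s z =1 link_symbols s' (z + d)}.
Proof.
move=> leL; pose Q := \prod_(A in links P) ('X - (a A)%:P).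
pose u b := rVpoly (row b (vec_mx s - vec_mx s')) * 'X^K.
have szQ : (size Q = #|links P|.+1)%nat.
  by rewrite /Q -big_enum size_prod_XsubC cardE.
have Q0 : Q != 0 by rewrite -size_poly_gt0 szQ.
pose rem b := u b %% Q.
have szrem b : (size (rem b) <= K)%nat.
  by rewrite (leq_trans _ leL) // -ltnS -szQ ltn_modp.
exists (\matrix_b poly_rV (rem b)) => z A LA; apply/rowP => b; rewrite !mxE.
rewrite /share_poly !linearD /= rowK poly_rV_K // !hornerE /rem horner_mod.
  by rewrite /u raddfB /= linearB /= !hornerE -addrA mulrBl subrK.
by rewrite /Q (bigD1 A) //= rootM root_XsubC eqxx.
Qed.

Lemma transfer_secure k l : (0 < k)%nat ->
  (forall P, #|P| = k -> K + r <= #|links P|)%nat ->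
  (forall P, #|P| <= l -> #|links P| <= K)%nat ->
  secure_scheme m transfer_scheme k l.
Proof.
move=> k0 leK geK.
have N0 : (0 < INR #|{: rkey}|)%R by apply/lt_0_INR/ltP/card_gt0P; exists 0.
have PK0 (z : rkey) : (0 <= / INR #|{: rkey}|)%R by left; apply: Rinv_0_lt_compat.
have PK1 : \big[Rplus/0%R]_(z : rkey) (/ INR #|{: rkey}|)%R = 1%R.
  by rewrite Rsum_const Rinv_r //; apply: Rgt_not_eq.
split=> // h vh X cX.
  have Cinj w w' : C_rv h X w = C_rv h X w' -> S_rv transfer_scheme w = S_rv transfer_scheme w'.
    move=> eqC; apply: (link_symbols_inj (leK X cX) (z := w.2) (z' := w'.2)) => A.
    move=> /linksP[i [j [ij iX ->]]].
    have := congr1 (fun o : {ffun _} => o i) eqC; rewrite !ffunE iX => -[].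
    rewrite !state_transfer // => /(congr1 vec_mx); rewrite !mxvecK.
    have [t -> _] := unlift_some ij.
    by move/row_matrixP/(_ t); rewrite !rowK.
  (* The decoder: any outcome with the given contents yields the right file by [Cinj]; 0 is returned
     only for contents that never occur. *)
  pose g u := if [pick w | C_rv h X w == u] is Some w then S_rv transfer_scheme w else 0.
  apply: (@cond_entropy_determined _ _ _ _ _ _ _ g) => w; rewrite /g.
  by case: pickP => [w' /eqP/Cinj //|/(_ w)]; rewrite eqxx.
apply: file_independent => // s s'.
(* One [d] serves all keys, so translation by [d] is a bijection that preserves the uniform law. *)
have [|d dP] := @link_symbols_rekey (@position h @: X) s s'.
  by apply: geK; rewrite (leq_trans (leq_imset_card _ _)).
exists (fun z : rkey => z + d); split.
  by exists (fun z : rkey => z - d) => z; rewrite ?addrK ?subrK.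
move=> z; split=> //; apply: esym; apply: D_rv_transfer_eq => // A; exact: dP.
Qed.

End RepairByTransfer.

(** * The capacity: both bounds meet *)

Theorem theorem2 (n k l beta : nat) :
  k <= n.-1 -> l < k -> 0 < beta ->
  exists q0 : nat, forall F : finFieldType, q0 <= #|F| ->
    secrecy_capacity_BL F n k n.-1 l (n.-1 * beta)
      (INR (\sum_(l.+1 <= i < k.+1) (n - i) * beta))
    /\ achievable F n k n.-1 l (n.-1 * beta) beta
         (\sum_(l.+1 <= i < k.+1) (n - i) * beta).
Proof.
case: n => [|m]; first by case: k.
(* [a] labels all subsets of the nodes injectively, so 2^n field elements suffice. *)
move=> /= km lk beta0; exists #|{: {set 'I_m.+1}}| => F leF.
have ach : achievable F m.+1 k m l (m * beta) beta (\sum_(l.+1 <= i < k.+1) (m.+1 - i) * beta).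
  rewrite -big_distrl /=; set r := \sum_(_ <= _ < _) _; rewrite [r * _]mulnC.
  pose a A : F := enum_val (widen_ord leF (enum_rank A)).
  have a_inj : injective a.
    by move=> A A' /enum_val_inj/(congr1 val) /= /val_inj/enum_rank_inj.
  (* [K] counts the edges that meet [l] nodes; by [sum_new_links], K + r counts those that meet [k]
     nodes. *)
  pose K := 'C(m.+1, 2) - 'C(m.+1 - l, 2).
  exists (transfer_scheme beta K r a); apply: transfer_secure => //.
  - exact: leq_ltn_trans lk.
  - move=> P cP; have := card_links P; rewrite cP.
    have := @sum_new_links m.+1 l k; rewrite (ltnW lk) leqW // -/r => /(_ isT).
    have := @leq_bin2l (m.+1 - l) m.+1 2 (leq_subr _ _).
    rewrite /K; lia.
  - move=> P cP; have := card_links P.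
    have := @leq_bin2l (m.+1 - l) (m.+1 - #|P|) 2 (leq_sub2l _ cP).
    rewrite /K; lia.
split=> //; split=> [_ [alpha [beta' [Rf [leG [[c sec] ->]]]]]|x ub].
  (* The converse covers every [alpha]; the budget m * beta' <= m * beta gives beta' <= beta since m
     > 0. *)
  apply/le_INR/leP; apply: leq_trans (secure_rate_le km lk sec) _.
  apply: leq_sum => i _; rewrite leq_mul2l; apply/orP; right.
  by move: leG; rewrite leq_pmul2l // (leq_trans _ km) // (leq_ltn_trans _ lk).
by apply: ub; exists (m * beta), beta, (\sum_(l.+1 <= i < k.+1) (m.+1 - i) * beta).
Qed.
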